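(* Let $(X,\cdot)$ and $(A,* )$ be two racks and let $\Phi: A\to \operatorname{Conj}(\operatorname{Aut}(X))$, $a\mapsto \Phi_a$, be a rack homomorphism. On the set $Y:=A\times X$ define the operation $$(a,x)\circ(b,y):=(a*b,\;x\Phi_b),\qquad a,b\in A,\ x,y\in X,$$ where $x\Phi_b$ denotes the image of $x$ under the automorphism $\Phi_b=\Phi(b)$. Then the groupoid $(Y,\circ)$ is a rack. Additionally, if $X$ and $A$ are quandles and every $a\in A$ lies in the kernel of $\Phi$ (that is, $\Phi_a=\mathrm{id}$ for every $a\in A$), then $(Y,\circ)$ is a quandle.
   Context: A groupoid is a non-empty set with a binary operation. A rack is a groupoid $(Q,* )$ such that (Q2) for all $x,y\in Q$ there is a unique $z\in Q$ with $x=z*y$, and (Q3) $(x*y)*z=(x*z)*(y*z)$ for all $x,y,z\in Q$. A quandle is a rack satisfying also (Q1) $x*x=x$ for all $x\in Q$. A rack homomorphism is a map preserving the operations. $\operatorname{Aut}(X)$ is the group of rack automorphisms of $X$, acting on the right: $x\varphi$ is the image of $x$ under $\varphi$, and the product is $x(\varphi\psi)=(x\varphi)\psi$. For a group $G$, $\operatorname{Conj}(G)$ is the quandle on the set $G$ with operation $a*b=b^{-1}ab$. *)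

(* Defs.v *)
From HB Require Import structures.
From mathcomp Require Import all_boot.
From mathcomp Require Import boolp.

Set Implicit Arguments.
Unset Strict Implicit.
Unset Printing Implicit Defensive.

Local Open Scope group_scope.

(* The binary operation of a groupoid Q : magmaType is written x * y. Since a
   magmaType may be empty, non-emptiness is part of is_rack. *)
Definition is_rack (Q : magmaType) : Prop :=
  [/\ inhabited Q,
      forall x y : Q, exists! z : Q, x = z * y
    & forall x y z : Q, (x * y) * z = (x * z) * (y * z)].

Definition is_quandle (Q : magmaType) : Prop :=
  is_rack Q /\ forall x : Q, x * x = x.

Record aut (X : magmaType) := Aut {
  aut_fun :> X -> X;
  autM : {morph aut_fun : x y / x * y};
  aut_bij : bijective aut_fun
}.

Lemma aut_ext (X : magmaType) (f g : aut X) : f =1 g -> f = g.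
Proof.
case: f g => [f fM fb] [g gM gb] /= /funext fg; case: _ / fg gM gb => gM gb.
by rewrite (Prop_irrelevance fM gM) (Prop_irrelevance fb gb).
Qed.

Section AutGroup.
Variable X : magmaType.
Implicit Types f g h : aut X.

Definition aut_one : aut X := @Aut X id (fun _ _ => erefl) (inv_bij (frefl id)).

(* Automorphisms act on the right: f g is "first f, then g". *)
Definition aut_mul f g : aut X.
Proof.
exists (g \o f); last exact: bij_comp (aut_bij g) (aut_bij f).
by move=> x y /=; rewrite !autM.
Defined.

Lemma aut_inv_subproof f : exists g : X -> X, cancel f g /\ cancel g f.
Proof. by case: (aut_bij f) => g fK gK; exists g. Qed.

Definition aut_inv_fun f : X -> X := projT1 (cid (aut_inv_subproof f)).

Lemma aut_invK f : cancel f (aut_inv_fun f).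
Proof. by rewrite /aut_inv_fun; case: cid => g []. Qed.

Lemma aut_invKV f : cancel (aut_inv_fun f) f.
Proof. by rewrite /aut_inv_fun; case: cid => g []. Qed.

Definition aut_inv f : aut X.
Proof.
exists (aut_inv_fun f); last by exists f; [exact: aut_invKV | exact: aut_invK].
by move=> x y; apply: (bij_inj (aut_bij f)); rewrite autM !aut_invKV.
Defined.

Lemma aut_mulA : associative aut_mul.
Proof. by move=> f g h; apply: aut_ext. Qed.

Lemma aut_mul1 : left_id aut_one aut_mul.
Proof. by move=> f; apply: aut_ext. Qed.

Lemma aut_mulr1 : right_id aut_one aut_mul.
Proof. by move=> f; apply: aut_ext. Qed.

Lemma aut_mulV : left_inverse aut_one aut_inv aut_mul.
Proof. by move=> f; apply: aut_ext => x /=; rewrite aut_invKV. Qed.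

Lemma aut_mulrV : right_inverse aut_one aut_inv aut_mul.
Proof. by move=> f; apply: aut_ext => x /=; rewrite aut_invK. Qed.

End AutGroup.

HB.instance Definition _ (X : magmaType) := gen_eqMixin (aut X).
HB.instance Definition _ (X : magmaType) := gen_choiceMixin (aut X).
HB.instance Definition _ (X : magmaType) := isGroup.Build (aut X)
  (@aut_mulA X) (@aut_mul1 X) (@aut_mulr1 X) (@aut_mulV X) (@aut_mulrV X).

(* A copy of G whose operation is conjugation a ^ b = b^-1 * (a * b). *)
Definition Conj (G : groupType) : Type := G.
HB.instance Definition _ (G : groupType) := hasMul.Build (Conj G) (@conjg G).

Lemma Conj_quandle (G : groupType) : is_quandle (Conj G).
Proof.
split; last by move=> x; exact: (mulKg (x : G) x).
split; first exact: (inhabits (1 : G)).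
- move=> x y; exists ((x : G) ^ (y : G)^-1); split.
    by symmetry; exact: (@conjgKV G y x).
  by move=> z ->; exact: (@conjgK G y z).
- by move=> x y z; exact: (@conjJg G x y z).
Qed.

(* The carrier is the full product A * X, but the operation is twisted by Phi
   and is not the componentwise one; its X-coordinate ignores y. *)
Definition twprod (X A : magmaType) (Phi : A -> Conj (aut X)) : Type :=
  (A * X)%type.

Definition twprod_op (X A : magmaType) (Phi : A -> Conj (aut X))
    (p q : twprod Phi) : twprod Phi :=
  let: (a, x) := p in let: (b, y) := q in (a * b, (Phi b : aut X) x).

HB.instance Definition _ (X A : magmaType) (Phi : A -> Conj (aut X)) :=
  hasMul.Build (twprod Phi) (@twprod_op X A Phi).

(* Main.v *)
Require Import Defs.
From mathcomp Require Import all_boot.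
Local Open Scope group_scope.

(** The two coordinates of [twprod Phi] can be treated separately. The first
    one is the rack [A]. On the second one, right translation by [(b, y)] is
    the automorphism [Phi b]; it is bijective, so right division in the product
    is right division in [A] paired with the inverse of [Phi b].
    Self-distributivity in the second coordinate says that applying [Phi b] and
    then [Phi c] is the same as applying [Phi c] and then [Phi (b * c)]. As
    [Phi (b * c)] is the conjugate of [Phi b] by [Phi c], this is the group
    identity [f g = g (f ^ g)], which is [conjgC] ([aut_conjgE] below).
    If moreover [Phi] is trivial, the second coordinate never changes, and
    idempotence is inherited from [A]. *)

Section TwistedProduct.
Variables (X A : magmaType) (Phi : {multiplicative A -> Conj (aut X)}).

(** Products of automorphisms compose from left to right, so this is the
    identity [f g = g (f ^ g)] evaluated at a point. *)
Lemma aut_conjgE (f g : aut X) (x : X) : (f ^ g) (g x) = g (f x).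
Proof. by have /(congr1 (fun h : aut X => h x)) := conjgC f g. Qed.

Lemma multiplicative_conjE (b c : A) (x : X) :
  (Phi (b * c) : aut X) ((Phi c : aut X) x)
  = (Phi c : aut X) ((Phi b : aut X) x).
Proof. by rewrite gmulfM; apply: aut_conjgE. Qed.

Lemma twprod_rack : inhabited X -> is_rack A -> is_rack (twprod Phi).
Proof.
move=> [x0] [[a0] divA distA]; split.
- exact: (inhabits ((a0, x0) : twprod Phi)).
- move=> [a x] [b y]; have [c [ac c_uniq]] := divA a b.
  exists (c, aut_inv_fun (Phi b) x); split.
    by congr pair; [| rewrite aut_invKV].
  by move=> [d z] [/c_uniq <- ->]; rewrite aut_invK.
- move=> [a x] [b y] [c z]; congr pair; first exact: distA.
  by symmetry; apply: multiplicative_conjE.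
Qed.

Lemma twprod_idem :
    (forall a : A, a * a = a) -> (forall a : A, Phi a = 1 :> aut X) ->
  forall p : twprod Phi, p * p = p.
Proof.
by move=> idemA Phi1 [a x]; congr pair; [exact: idemA | rewrite Phi1].
Qed.

End TwistedProduct.

Theorem theorem4p1 (X A : magmaType) (rackX : is_rack X) (rackA : is_rack A)
    (Phi : {multiplicative A -> Conj (aut X)}) :
  is_rack (twprod Phi) /\
  (is_quandle X -> is_quandle A ->
   (forall a : A, Phi a = 1 :> aut X) ->
   is_quandle (twprod Phi)).
Proof.
have [inhX _ _] := rackX; have rackY := twprod_rack X A Phi inhX rackA.
by split=> // _ [_ idemA] Phi1; split=> //; apply: twprod_idem.
Qed.
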